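(* Let $\mathcal{G} = \{(y_a,b_a) \mid a \in A\}$ be a finite subset of $\mathbb{Z}\wr\mathbb{Z}$ indexed by a finite set $A$, and let $I = \{a \in A \mid b_a > 0\}$, $J = \{a \in A\mid b_a<0\}$, $K = \{a\in A\mid b_a = 0\}$. Suppose $I \neq \emptyset$ and $J \neq\emptyset$. Let $d = \gcd(\{b_a \mid a \in I\cup J\}) \geq 1$ and, for $(i,j)\in I\times J$, let $$h_{(i,j)} = \frac{y_i}{1 + X^d + \cdots + X^{b_i - d}} + \frac{y_j}{X^{-d} + X^{-2d} + \cdots + X^{-|b_j|}} \in \mathbb{Q}(X).$$ Then the semigroup $\langle\mathcal{G}\rangle$ is a group if and only if there exist a double-full set $S\subset I\times J$ and polynomials $f_{(i,j)}, f_k \in \mathbb{N}[X^{\pm d}]^*$ for $(i,j)\in S$, $k \in K$, such that the following three conditions hold: (i) $\sum_{(i,j)\in S} f_{(i,j)}\cdot h_{(i,j)} + \sum_{k\in K} f_k\cdot y_k = 0$ in $\mathbb{Q}(X)$; (ii) $\deg_+\left(\sum_{(i,j)\in S} f_{(i,j)}\right) + d \geq \deg_+\left(\sum_{k\in K} f_k\right)$; (iii) $\deg_-\left(\sum_{(i,j)\in S} f_{(i,j)}\right) \leq \deg_-\left(\sum_{k\in K} f_k\right)$.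
   Context: $\mathbb{Z}\wr\mathbb{Z}$ is the group of pairs $(y,b)$ with $y$ in the Laurent polynomial ring $\mathbb{Z}[X^{\pm}]$ and $b\in\mathbb{Z}$, with multiplication $(y,b)\cdot(y',b') = (y+X^b y', b+b')$ and neutral element $(0,0)$. $\langle\mathcal{G}\rangle$ is the semigroup generated by $\mathcal{G}$ (all products of non-empty finite sequences of elements of $\mathcal{G}$). A subset $S\subset I\times J$ is double-full if for every $i\in I$ there is $j\in J$ with $(i,j)\in S$, and for every $j\in J$ there is $i\in I$ with $(i,j)\in S$. $\mathbb{N}[X^{\pm d}]^*$ is the set of non-zero Laurent polynomials in $X^d$ with coefficients in $\mathbb{N}=\{0,1,2,\dots\}$, i.e. non-zero Laurent polynomials with non-negative integer coefficients all of whose monomials have degree divisible by $d$. For a non-zero Laurent polynomial $f=\sum_{i=p}^q a_iX^i$ with $a_p,a_q\ne0$, $\deg_-(f)=p$ and $\deg_+(f)=q$; moreover $\deg_-(0)=+\infty$ and $\deg_+(0)=-\infty$. $\mathbb{Q}(X)$ is the field of rational functions. *)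

(* Defs.v *)
From HB Require Import structures.
From mathcomp Require Import all_boot all_order all_algebra.
From mathcomp Require Import finmap monalg constructive_ereal.

Set Implicit Arguments.
Unset Strict Implicit.
Unset Printing Implicit Defensive.

Import Order.TTheory GRing.Theory Num.Theory.

Local Open Scope fset_scope.
Local Open Scope ring_scope.

(* [f@_k] is the coefficient of [X^k] in [f] and [msupp f] the finite set of
   exponents with non-zero coefficient.  The product has to be defined here:
   [monalg] provides one only for monoids of exponents without non-trivial
   invertible elements, which excludes [int]. *)
Definition laurent : Type := {malg int[int]}.

HB.instance Definition _ := GRing.Zmodule.on laurent.

Definition lX (k : int) : laurent := << 1 *g k >>.

Definition laurent_mul (f g : laurent) : laurent :=
  \sum_(i <- msupp f) \sum_(j <- msupp g) << f@_i * g@_j *g i + j >>.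

Section LaurentRing.

Implicit Types f g : laurent.

Let mulw (D E : {fset int}) f g : msupp f `<=` D -> msupp g `<=` E ->
  laurent_mul f g = \sum_(i <- D) \sum_(j <- E) << f@_i * g@_j *g i + j >>.
Proof.
move=> fD gE; rewrite /laurent_mul (big_fset_incl _ fD) /=; last first.
  move=> i _ /mcoeff_outdom fi.
  by rewrite big1 // => j _; rewrite fi mul0r monalgU0.
apply: eq_bigr => i _; apply: big_fset_incl => // j _ /mcoeff_outdom ->.
by rewrite mulr0 monalgU0.
Qed.

Let mulC : commutative laurent_mul.
Proof.
move=> f g; rewrite /laurent_mul exchange_big; apply: eq_bigr => i _.
by apply: eq_bigr => j _; rewrite mulrC addrC.
Qed.

Let mulDl : left_distributive laurent_mul +%R.
Proof.
move=> f g h.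
rewrite (mulw (msuppD_le f g) (fsubset_refl _)).
rewrite (mulw (fsubsetUl _ (msupp g)) (fsubset_refl _)).
rewrite (mulw (fsubsetUr (msupp f) _) (fsubset_refl _)) -big_split /=.
apply: eq_bigr => i _; rewrite -big_split /=; apply: eq_bigr => j _.
by rewrite mcoeffD mulrDl monalgUD.
Qed.

Let mulDr : right_distributive laurent_mul +%R.
Proof. by move=> f g h; rewrite mulC mulDl !(mulC f). Qed.

Let mul0l : left_zero 0 laurent_mul.
Proof. by move=> f; rewrite /laurent_mul msupp0 big_seq_fset0. Qed.

Let mul0r_ : right_zero 0 laurent_mul.
Proof. by move=> f; rewrite mulC mul0l. Qed.

Let mulUU (a c : int) (i j : int) :
  laurent_mul << a *g i >> << c *g j >> = << a * c *g i + j >>.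
Proof. by rewrite (mulw msuppU_le msuppU_le) !big_seq_fset1 !mcoeffUU. Qed.

Let mul_suml (I : Type) (r : seq I) (F : I -> laurent) g :
  laurent_mul (\sum_(i <- r) F i) g = \sum_(i <- r) laurent_mul (F i) g.
Proof. exact: (big_morph (laurent_mul^~ g) (fun x y => mulDl x y g) (mul0l g)). Qed.

Let mul_sumr (I : Type) (r : seq I) (F : I -> laurent) g :
  laurent_mul g (\sum_(i <- r) F i) = \sum_(i <- r) laurent_mul g (F i).
Proof. exact: (big_morph (laurent_mul g) (mulDr g) (mul0r_ g)). Qed.

Let mulA : associative laurent_mul.
Proof.
move: mulUU mul_suml mul_sumr; move: laurent_mul => m mUU m_suml m_sumr f g h.
rewrite (monalgE f) !m_suml; apply: eq_bigr => i _.
rewrite (monalgE g) m_sumr !m_suml m_sumr; apply: eq_bigr => j _.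
rewrite (monalgE h) !m_sumr; apply: eq_bigr => k _.
by rewrite !mUU mulrA addrA.
Qed.

Let mul1l : left_id (lX 0) laurent_mul.
Proof.
move=> f; rewrite (monalgE f) mul_sumr; apply: eq_bigr => i _.
by rewrite mulUU mul1r add0r.
Qed.

Let one_neq0 : lX 0 != 0.
Proof. by rewrite monalgU_eq0 oner_eq0. Qed.

HB.instance Definition _ :=
  GRing.Zmodule_isComNzRing.Build laurent mulA mulC mul1l mulDl one_neq0.

Lemma lXD (i j : int) : lX (i + j) = lX i * lX j.
Proof. by rewrite [RHS]mulUU mulr1. Qed.

End LaurentRing.

Definition degp (f : laurent) : \bar int :=
  \big[Order.max/-oo%E]_(k <- msupp f) k%:E.

Definition degm (f : laurent) : \bar int :=
  \big[Order.min/+oo%E]_(k <- msupp f) k%:E.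

(* The set N[X^{+-d}]^*. *)
Definition nat_laurent_nz (d : nat) (f : laurent) : Prop :=
  [/\ f != 0, forall k : int, 0 <= f@_k
    & forall k : int, k \in msupp f -> (d %| k)%Z].

Definition QX : fieldType := {fraction {poly rat}}.

Definition qX : QX := tofrac 'X.

Definition toQX (f : laurent) : QX :=
  mmap (fun c : int => c%:~R) (fun k : int => qX ^ k) f.

Definition ZwrZ : Type := (laurent * int)%type.

HB.instance Definition _ := Choice.on ZwrZ.

Definition wr_one : ZwrZ := (0, 0).

Definition wr_mul (u v : ZwrZ) : ZwrZ := (u.1 + lX u.2 * v.1, u.2 + v.2).

Definition wr_inv (u : ZwrZ) : ZwrZ := (- (lX (- u.2) * u.1), - u.2).

Section WreathGroup.

Let mulA : associative wr_mul.
Proof.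
move=> u v w; rewrite /wr_mul /=; congr pair; last by rewrite addrA.
by rewrite lXD mulrDr !mulrA addrA.
Qed.

Let mul1w : left_id wr_one wr_mul.
Proof. by case=> y b; rewrite /wr_mul /= !add0r [lX 0 * y]mul1r. Qed.

Let mulw1 : right_id wr_one wr_mul.
Proof. by case=> y b; rewrite /wr_mul /= mulr0 !addr0. Qed.

Let mulVw : left_inverse wr_one wr_inv wr_mul.
Proof. by case=> y b; rewrite /wr_mul /= !addNr. Qed.

Let mulwV : right_inverse wr_one wr_inv wr_mul.
Proof.
case=> y b; rewrite /wr_mul /= mulrN mulrA -lXD !subrr.
by rewrite [lX 0 * y]mul1r subrr.
Qed.

HB.instance Definition _ :=
  isGroup.Build ZwrZ mulA mul1w mulw1 mulVw mulwV.

End WreathGroup.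

Definition generated_semigroup (T : monoidType) (G : {pred T}) (x : T) : Prop :=
  exists s : seq T,
    [/\ s != [::], {subset s <= G} & x = (\prod_(z <- s) z)%g].

(* [S] is a group for the operation of [T]; the neutral element and the
   inverses are not required to be those of [T]. *)
Definition is_group (T : magmaType) (S : T -> Prop) : Prop :=
  (forall x y, S x -> S y -> S (x * y)%g) /\
  exists2 e, S e &
    forall x, S x ->
      [/\ (e * x)%g = x, (x * e)%g = x
        & exists2 x', S x' & (x * x')%g = e /\ (x' * x)%g = e].

Definition double_full (A : finType) (I J : {set A}) (S : {set A * A}) : Prop :=
  [/\ S \subset setX I J,
      forall i, i \in I -> exists2 j, j \in J & (i, j) \in S
    & forall j, j \in J -> exists2 i, i \in I & (i, j) \in S].

(* Meant for [b i > 0], [b j < 0] and [d] dividing both. *)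
Definition h_pair (A : finType) (y : A -> laurent) (b : A -> int) (d : nat)
    (p : A * A) : QX :=
  let: (i, j) := p in
    toQX (y i) / (\sum_(0 <= k < `|b i|%N %/ d) qX ^+ (d * k))
  + toQX (y j) / (\sum_(1 <= k < (`|b j|%N %/ d).+1) qX ^- (d * k)).

(* Main.v *)
Require Import Defs.
From HB Require Import structures.
From mathcomp Require Import all_boot all_order all_algebra.
From mathcomp Require Import finmap monalg constructive_ereal.
From mathcomp Require Import zify ring.

(* A word over the generators is a walk on the integers in which the letter [a],
   read at position [p], contributes [X^p y_a] and moves to [p + b_a].  The
   semigroup is a group iff some word using every letter has product 1.  Letting
   [F_a] be the sum of the [X^p] over the positions [p] at which [a] is read, such
   words correspond, by Euler's theorem, to families of non-zero [F_a] with
   natural coefficients such that [sum F_a y_a = 0], [sum F_a (1 - X^(b_a)) = 0],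
   and whose edges form a connected multigraph.
   Let [D_a] be [1 - X^(b_a)] divided by [1 - X^d], up to sign, and let
   [T_a = F_a D_a], which counts the crossings of each gap [[p, p + d]] by [a].
   Balance says that the [T_i], [i] in [I], and the [T_j], [j] in [J], have the
   same sum, so they are the row and column sums of a matrix [f_(i,j)]; the
   degree conditions hold because a letter of [K] is always read at a position
   where some letter of [I] or [J] is read too.
   Conversely, multiply the given polynomials by the product of all [D_a] and by
   a long window [X^(-Nd) + ... + X^(Nd)].  The first factor makes the [T_a]
   divisible by [D_a].  The second makes the support of each [F_a] an interval
   of multiples of [d] containing a large neighbourhood of 0, where a Bezout
   relation gives connectivity, and any vertex is joined to this neighbourhood by
   steps of a single letter.  The degree conditions put the loops of [K] on this
   connected component. *)

Set Implicit Arguments.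
Unset Strict Implicit.
Unset Printing Implicit Defensive.

Import Order.TTheory GRing.Theory Num.Theory.

Local Open Scope ring_scope.

Implicit Types f g P : laurent.

(** * Coefficients and embedding into the rational functions *)

Lemma laurentP f g : (forall k, f@_k = g@_k) -> f = g.
Proof. by move=> h; apply/malgP. Qed.

Lemma lcoef0 k : (0 : laurent)@_k = 0.
Proof. exact: mcoeff0. Qed.

Lemma lcoefD f g k : (f + g)@_k = f@_k + g@_k.
Proof. exact: mcoeffD. Qed.

Lemma lcoef_sum (T : Type) (r : seq T) (p : pred T) (F : T -> laurent) k :
  (\sum_(i <- r | p i) F i)@_k = \sum_(i <- r | p i) (F i)@_k.
Proof. by apply: (big_morph (fun f : laurent => f@_k) (fun f g => lcoefD f g k) (lcoef0 k)). Qed.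

Lemma lcoefX i k : (lX i)@_k = (i == k)%:R.
Proof. by rewrite mcoeffU; case: eqP. Qed.

Lemma lX0 : lX 0 = 1.
Proof. by []. Qed.

Lemma lcoefM f g k : (f * g)@_k = \sum_(i <- msupp f) f@_i * g@_(k - i).
Proof.
rewrite [f * g]/(laurent_mul f g) lcoef_sum; apply: eq_bigr => i _.
rewrite lcoef_sum.
have e j : << f@_i * g@_j *g i + j >>@_k = if j == k - i then f@_i * g@_j else 0.
  rewrite mcoeffU eq_sym [j == _]eq_sym subr_eq addrC eq_sym.
  by case: eqP; rewrite ?mulr1n ?mulr0n // [i + j]addrC eq_sym.
under eq_bigr do rewrite e.
rewrite -big_mkcond /=.
have [kg|kg] := boolP (k - i \in msupp g).
  by rewrite -big_filter filter_pred1_uniq ?fset_uniq // big_seq1.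
rewrite (mcoeff_outdom kg) mulr0 big1_seq // => j /andP[/eqP-> ].
by rewrite (negbTE kg).
Qed.

Lemma qX_neq0 : qX != 0.
Proof. by rewrite tofrac_eq0 polyX_eq0. Qed.

Lemma toQXU c k : toQX << c *g k >> = c%:~R * qX ^ k.
Proof. exact: mmapU. Qed.

Fact toQX_is_additive : {morph toQX : f g / f - g}.
Proof. by move=> f g; exact: mmapB. Qed.

HB.instance Definition _ := GRing.isZmodMorphism.Build laurent QX toQX toQX_is_additive.

Fact toQX_is_monoid_morphism : monoid_morphism toQX.
Proof.
split=> [|f g]; first by rewrite [toQX 1]toQXU mulr1.
rewrite [f * g]/(laurent_mul f g) raddf_sum mulr_suml; apply: eq_bigr => i _.
rewrite raddf_sum mulr_sumr; apply: eq_bigr => j _.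
by rewrite [LHS]toQXU expfzDr ?qX_neq0 // intrM mulrACA.
Qed.

HB.instance Definition _ := GRing.isMonoidMorphism.Build laurent QX toQX toQX_is_monoid_morphism.

Lemma toQXX k : toQX (lX k) = qX ^ k.
Proof. by rewrite toQXU mul1r. Qed.

(** A large power of [X] turns [f] into a polynomial with the same coefficients, and polynomials
    embed into their fraction field. *)
Lemma toQX_eq0 f : toQX f = 0 -> f = 0.
Proof.
move=> f0; apply: laurentP => k; rewrite lcoef0.
have [kf|] := boolP (k \in msupp f); last by apply: mcoeff_outdom.
pose n := (\max_(i <- msupp f) absz i)%N.
have nP (i : int) : i \in msupp f -> i + n%:Z = absz (i + n%:Z).
  move=> i_f; have : (absz i <= n)%N by rewrite /n (big_rem i) //= leq_max leqnn.
  lia.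
pose p : {poly rat} := \sum_(i <- msupp f) (f@_i)%:~R *: 'X^(absz (i + n%:Z)).
have p0 : p = 0.
  apply/eqP; rewrite -tofrac_eq0 rmorph_sum /=; apply/eqP.
  transitivity (toQX f * qX ^ n%:Z); last by rewrite f0 mul0r.
  rewrite mulr_suml big_seq [RHS]big_seq; apply: eq_bigr => i i_f.
  rewrite -mulrA -expfzDr ?qX_neq0 // nP // -mul_polyC rmorphM /=.
  by rewrite rmorph_int rmorph_int rmorphXn.
move: p0 => /(congr1 (fun q : {poly rat} => q`_(absz (k + n%:Z)))).
rewrite coef0 coef_sum (big_rem k) //= coefZ coefXn eqxx mulr1.
rewrite big1_seq ?addr0 => [|i /andP[_ ik]].
  by move/eqP; rewrite intr_eq0 => /eqP.
have iN : i != k by apply: contraTneq ik => ->; rewrite mem_rem_uniq ?fset_uniq // inE eqxx.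
rewrite coefZ coefXn; case: eqP; rewrite ?mulr0 // => e.
have := nP _ kf; rewrite e -nP ?(mem_rem ik) // => /addIr ki.
by rewrite ki eqxx in iN.
Qed.

Lemma toQX_inj : injective toQX.
Proof. exact: raddf_inj toQX_eq0. Qed.

(** * Eulerian circuits *)

Section Eulerian.
Local Open Scope nat_scope.

Variables (T V : eqType) (src tgt : T -> V).
Implicit Types (u v x : V) (e : T) (s c r E : seq T).

(** A finite multigraph is a sequence of edges, repetitions giving parallel edges; the vertex type
    [V] may be infinite. *)
Fixpoint walk u s v : bool :=
  if s is e :: s' then (src e == u) && walk (tgt e) s' v else u == v.

Definition outdeg s x := count (fun e => src e == x) s.
Definition indeg s x := count (fun e => tgt e == x) s.

Lemma walk_cat u s1 s2 v w :
  walk u s1 v -> walk v s2 w -> walk u (s1 ++ s2) w.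
Proof.
elim: s1 u => [|e s1 IH] u /=; first by move/eqP->.
by case/andP=> -> /= /IH; apply.
Qed.

Lemma walk_deg u s v x :
  walk u s v -> outdeg s x + (v == x) = indeg s x + (u == x).
Proof.
rewrite /outdeg /indeg; elim: s u => [|e s IH] u /=; first by move/eqP->.
by case/andP=> /eqP-> /IH; lia.
Qed.

Lemma walk_split u s v x : walk u s v -> has (fun e => src e == x) s ->
  exists s1 s2, [/\ s = s1 ++ s2, walk u s1 x & walk x s2 v].
Proof.
elim: s u => //= e s IH u /andP[eu sv]; have [ex _|ex /= /(IH _ sv)] := eqVneq (src e) x.
  by exists [::], (e :: s); rewrite /= -ex eqxx sv eq_sym eu.
by move=> [s1 [s2 [-> w1 w2]]]; exists (e :: s1), s2; rewrite /= eu w1.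
Qed.

Lemma perm_outdeg E s x : perm_eq E s -> outdeg E x = outdeg s x.
Proof. by move/permP; apply. Qed.

Lemma perm_indeg E s x : perm_eq E s -> indeg E x = indeg s x.
Proof. by move/permP; apply. Qed.

Lemma outdeg_gt0 E x : 0 < outdeg E x ->
  exists2 e, e \in E & src e = x.
Proof. by rewrite -has_count => /hasP[e eE /eqP]; exists e. Qed.

(* Following unused edges from [u], one can only get stuck at [v]. *)
Lemma greedy_walk E u v :
  (forall x, outdeg E x + (v == x) = indeg E x + (u == x)) ->
  exists c r, walk u c v /\ perm_eq E (c ++ r).
Proof.
have [n] := ubnP (size E); elim: n E u => // n IH E u sE bal.
have [uv|uv] := eqVneq u v; first by exists [::], E; rewrite /= uv.
(* Since [u != v], the balance at [u] leaves one more outgoing edge than incoming ones. *)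
have [|e eE eu] := @outdeg_gt0 E u.
  by have := bal u; rewrite eqxx eq_sym (negbTE uv); lia.
have E_e := perm_to_rem eE.
have [||c [r [cw rP]]] := IH (rem e E) (tgt e).
- by rewrite size_rem //; case: E eE sE {bal E_e}.
- move=> x; have := bal x.
  by rewrite (perm_outdeg x E_e) (perm_indeg x E_e) /outdeg /indeg /= eu; lia.
exists (e :: c), r; rewrite /= eu eqxx cw; split=> //.
by rewrite (perm_trans E_e) // perm_cons.
Qed.

Theorem euler_circuit E v0 :
  (forall x, outdeg E x = indeg E x) ->
  (forall W : pred V, W v0 -> (forall e, e \in E -> W (src e) = W (tgt e)) ->
     forall e, e \in E -> W (src e)) ->
  exists2 s, walk v0 s v0 & perm_eq s E.
Proof.
move=> bal conn.
suff main n s r : size r < n -> walk v0 s v0 -> perm_eq E (s ++ r) ->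
    exists2 s, walk v0 s v0 & perm_eq s E.
  by apply: (main (size E).+1 [::] E) => /=; rewrite ?eqxx.
elim: n s r => // n IH s r sr ws E_sr.
have balr x : outdeg r x = indeg r x.
  have := bal x; rewrite (perm_outdeg x E_sr) (perm_indeg x E_sr).
  by rewrite /outdeg /indeg !count_cat; have := walk_deg x ws; rewrite /outdeg /indeg; lia.
have [r0|r_neq0] := eqVneq r [::].
  by exists s => //; rewrite perm_sym; rewrite r0 cats0 in E_sr.
(* The vertices visited by [s]; [v0] is listed apart because [s] may be empty. *)
pose W x := (v0 == x) || has (fun e => src e == x) s.
have [/hasP[e er We]|noW] := boolP (has (fun e => W (src e)) r).
  have [s1 [s2 [s_def w1 w2]]] : exists s1 s2,
      [/\ s = s1 ++ s2, walk v0 s1 (src e) & walk (src e) s2 v0].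
    case/orP: We => [/eqP<-|]; last exact: walk_split.
    by exists [::], s; rewrite /= eqxx.
  have r_e := perm_to_rem er.
  have [x|c [r' [wc rP]]] := @greedy_walk (rem e r) (tgt e) (src e).
    have := balr x; rewrite (perm_outdeg x r_e) (perm_indeg x r_e).
    by rewrite /outdeg /indeg /=; lia.
  apply: (IH (s1 ++ (e :: c) ++ s2) r').
  - have := perm_size rP; have := perm_size r_e; rewrite size_cat /=; lia.
  - by apply: walk_cat w1 _; apply: walk_cat w2; rewrite /= eqxx.
  - apply: (perm_trans E_sr); rewrite s_def -!catA perm_cat2l /=.
    apply: perm_trans (_ : perm_eq _ (s2 ++ e :: c ++ r')) _.
      by rewrite perm_cat2l (perm_trans r_e) // perm_cons.
    by rewrite -cat_cons perm_catCA.
have noWt e : e \in r -> ~~ W (tgt e).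
  move=> er; apply: contra noW => We.
  have [|e' e'r e'x] := @outdeg_gt0 r (tgt e).
    by rewrite balr -has_count; apply/hasP; exists e.
  by apply/hasP; exists e' => //; rewrite e'x.
case: r r_neq0 E_sr noW noWt {sr balr} => // e0 r _ E_sr noW noWt.
suff /negP[] : ~~ W (src e0).
  apply: conn; rewrite ?(perm_mem E_sr) ?mem_cat ?inE ?eqxx ?orbT //.
    by rewrite /W eqxx.
  move=> e; rewrite (perm_mem E_sr) mem_cat => /orP[es|er]; last first.
    rewrite (negbTE (noWt _ er)); apply/negbTE; apply: contra noW => We.
    by apply/hasP; exists e.
  have -> : W (src e) by apply/orP; right; apply/hasP; exists e.
  apply/esym/orP; have := walk_deg (tgt e) ws.
  have : 0 < indeg s (tgt e) by rewrite -has_count; apply/hasP; exists e.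
  case: eqP => [|_]; [by left | rewrite addn0 => h e1; right].
  by rewrite has_count -/(outdeg s (tgt e)); lia.
by apply: contra noW => We; apply/hasP; exists e0; rewrite ?inE ?eqxx.
Qed.

End Eulerian.

(** * Words and walks *)

Section GroupWord.
Local Open Scope group_scope.

Variables (A : finType) (T : groupType) (g : A -> T).

Definition wprod (w : seq A) : T := \prod_(a <- w) g a.

Lemma wprod_cat u v : wprod (u ++ v) = wprod u * wprod v.
Proof. exact: big_cat. Qed.

Lemma wprod_cons a u : wprod (a :: u) = g a * wprod u.
Proof. exact: big_cons. Qed.

Lemma generated_wordP x :
  generated_semigroup (mem (codom g)) x <-> exists2 w, w != [::] & x = wprod w.
Proof.
split=> [[s [s0 sG ->]]|[w w0 ->]].
  have [w s_w] : exists w, s = map g w.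
    elim: s sG {s0} => [|z s IH] sG; first by exists [::].
    have [|w ->] := IH; first by move=> t ts; apply: sG; rewrite inE ts orbT.
    have /codomP[a ->] := sG z (mem_head _ _).
    by exists (a :: w).
  by exists w; [apply: contraNneq s0 => w0; rewrite s_w w0|rewrite s_w big_map].
exists (map g w); split; [by case: w w0| |by rewrite big_map].
by move=> z /mapP[a _ ->]; apply: codom_f.
Qed.

(** The neutral element is idempotent, hence 1, and the product of all letters has an inverse that
    is again a word. Conversely, rotating a word of product 1 to start with a given letter [a]
    exhibits the inverse of [g a] as the product of the remaining letters. *)
Lemma is_group_wordP (a0 : A) :
  is_group (generated_semigroup (mem (codom g))) <->
  exists2 w, (forall a, a \in w) & wprod w = 1.
Proof.
split=> [[_ [e Ge eP]]|[w wA w1]].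
  have e1 : e = 1.
    by have [ee _ _] := eP e Ge; apply: (mulgI e); rewrite ee mulg1.
  have [|_ _ [x' /generated_wordP[w' _ ->] []]] := eP (wprod (enum A)).
    apply/generated_wordP; exists (enum A) => //.
    by apply/eqP => A0; have := mem_enum A a0; rewrite A0.
  rewrite e1 -wprod_cat => p1 _; exists (enum A ++ w') => // a.
  by rewrite mem_cat mem_enum.
have w0 : w != [::] by apply: contraTneq (wA a0) => ->.
have invP u : exists2 v, v != [::] & wprod u * wprod v = 1.
  elim: u => [|a u [v v0 uv]]; first by exists w; rewrite // /wprod big_nil mul1g.
  have [w1' [w2 w_def]] : exists w1 w2, w = w1 ++ a :: w2.
    by case/splitPr: (wA a) => p q; exists p, q.
  exists (v ++ w2 ++ w1'); first by case: v v0 {uv}.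
  rewrite wprod_cons !wprod_cat !mulgA -(mulgA (g a) (wprod u)) uv mulg1.
  move: w1; rewrite w_def wprod_cat wprod_cons => /(canRL (mulKg _)).
  by rewrite mulg1 => ->; rewrite mulVg.
split=> [x y /generated_wordP[u u0 ->] /generated_wordP[v v0 ->]|].
  apply/generated_wordP; exists (u ++ v); last by rewrite wprod_cat.
  by case: u u0.
exists 1; first by apply/generated_wordP; exists w.
move=> x /generated_wordP[u u0 ->]; rewrite mul1g mulg1; split=> //.
have [v v0 uv] := invP u; exists (wprod v); first by apply/generated_wordP; exists v.
split=> //; move: uv => /(canRL (mulKg _)); rewrite mulg1 => ->.
by rewrite mulVg.
Qed.

End GroupWord.

(** * Words as walks on the integers *)

Section Trace.

Variables (A : finType) (y : A -> laurent) (b : A -> int).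

Definition gen (a : A) : ZwrZ := (y a, b a).

(** The pair [(a, p)] is the letter [a] read at position [p], an edge from [p] to [p + b a]. *)
Definition esrc (e : A * int) : int := e.2.
Definition etgt (e : A * int) : int := e.2 + b e.1.

Fixpoint trace (p : int) (w : seq A) : seq (A * int) :=
  if w is a :: w' then (a, p) :: trace (p + b a) w' else [::].

Lemma trace_cat p u v :
  trace p (u ++ v) = trace p u ++ trace (p + \sum_(a <- u) b a) v.
Proof.
elim: u p => [|a u IH] p /=; first by rewrite big_nil addr0.
by rewrite IH big_cons addrA.
Qed.

Lemma map_fst_trace p w : map fst (trace p w) = w.
Proof. by elim: w p => //= a w IH p; rewrite IH. Qed.

Lemma walkE p s q : walk esrc etgt p s q ->
  s = trace p (map fst s) /\ q = p + \sum_(a <- map fst s) b a.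
Proof.
elim: s p => [|[a r] s IH] p /=; first by move/eqP->; rewrite big_nil addr0.
case/andP=> /eqP e /IH[h1 h2]; move: e h1 h2; rewrite /esrc /etgt /= => -> h1 ->.
by rewrite {1}h1 big_cons addrA.
Qed.

(** The starting position is kept general because reading a letter shifts it for the rest of the
    word. *)
Lemma wprod_trace p w :
  (lX p * (wprod gen w).1 = \sum_(e <- trace p w) lX e.2 * y e.1) /\
  (wprod gen w).2 = \sum_(a <- w) b a.
Proof.
elim: w p => [|a w IH] p.
  by rewrite /wprod /= !big_nil mulr0.
have [IH1 IH2] := IH (p + b a).
rewrite wprod_cons big_cons /= big_cons -IH1 -IH2 /=; split=> //.
by rewrite lXD mulrDr mulrA.
Qed.

Lemma wprod_eq1 w : wprod gen w = 1%g <->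
  \sum_(e <- trace 0 w) lX e.2 * y e.1 = 0 /\ \sum_(a <- w) b a = 0.
Proof.
have [<- <-] := wprod_trace 0 w; rewrite lX0 mul1r.
by split=> [->|[]] //; case: (wprod _ _) => /= c d -> ->.
Qed.

End Trace.

(** * Words and their contents *)

Definition lnonneg f := forall k, 0 <= f@_k.

Lemma lnonneg_gt0P f : lnonneg f -> f != 0 -> exists k, 0 < f@_k.
Proof.
move=> f0 fN0; case: (fset_0Vmem (msupp f)) => [e|[k]].
  case/eqP: fN0; apply: laurentP => k; rewrite lcoef0.
  by apply: mcoeff_outdom; rewrite e.
by rewrite -mcoeff_neq0 => fk; exists k; rewrite lt_def f0 fk.
Qed.

Lemma lpos_neq0 f k : 0 < f@_k -> f != 0.
Proof. by apply: contraTneq => ->; rewrite lcoef0. Qed.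

Lemma lcoef_sumX (T : Type) (r : seq T) (h : T -> int) k :
  (\sum_(e <- r) lX (h e))@_k = (count (fun e => h e == k) r)%:R.
Proof.
rewrite lcoef_sum -sum1_count natr_sum [RHS]big_mkcond /=.
by apply: eq_bigr => e _; rewrite lcoefX; case: eqP.
Qed.

Lemma lnonneg_monomials f : lnonneg f -> exists s, f = \sum_(p <- s) lX p.
Proof.
move=> f0; exists (flatten [seq nseq (absz f@_p) p | p <- msupp f]).
rewrite big_flatten big_map.
transitivity (\sum_(p <- msupp f) (<< f@_p *g p >> : laurent)); first exact: monalgE.
apply: eq_bigr => p _.
rewrite big_nseq iter_addr_0; apply/malgP => k.
rewrite mcoeffMn !mcoeffU; have := f0 p; case: eqP => _; rewrite ?mulr0n ?mul0rn //.
rewrite !mulr1n natz; lia.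
Qed.

Section Content.

Variables (A : finType) (y : A -> laurent) (b : A -> int).

(** Here [s] is any multigraph of edges, not necessarily a walk. *)
Definition content (s : seq (A * int)) (a : A) : laurent :=
  \sum_(e <- s | e.1 == a) lX e.2.

Lemma content_sum s (G : A -> laurent) :
  \sum_(e <- s) lX e.2 * G e.1 = \sum_a content s a * G a.
Proof.
rewrite (partition_big (fun e => e.1) predT) //=; apply: eq_bigr => a _.
by rewrite mulr_suml; apply: eq_bigr => e /eqP->.
Qed.

Lemma content_coef s a k : (content s a)@_k = (count_mem (a, k) s)%:R.
Proof.
rewrite /content -big_filter lcoef_sumX count_filter; congr (_%:R).
by apply: eq_count => -[a' k'] /=; rewrite xpair_eqE andbC.
Qed.

Lemma content_gt0 s a k : (0 < (content s a)@_k) = ((a, k) \in s).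
Proof. by rewrite content_coef ltr0n -has_count has_pred1. Qed.

Lemma content_exists (F : A -> laurent) : (forall a, lnonneg (F a)) ->
  exists s, forall a, content s a = F a.
Proof.
move=> F0; have [s sP] := fin_all_exists (fun a => lnonneg_monomials (F0 a)).
exists (flatten [seq map (pair a) (s a) | a <- enum A]) => a.
rewrite sP /content big_flatten big_map big_enum (bigD1 a) //=.
rewrite big_map /= eqxx [X in _ + X]big1 ?addr0 // => a' a'a.
by rewrite big_map big_pred0 //= => _; apply/negbTE.
Qed.

Lemma trace_telescope p w :
  \sum_(e <- trace b p w) lX e.2 * (1 - lX (b e.1)) =
  lX p - lX (p + \sum_(a <- w) b a).
Proof.
elim: w p => [|a w IH] p /=; first by rewrite !big_nil addr0 subrr.
by rewrite !big_cons IH /= mulrBr mulr1 -lXD addrA addrA subrK.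
Qed.

(** Letters of [K] do not move the walk, so the first letter outside [K] is still read at the
    starting position. *)
Lemma trace_nonK (K : {set A}) p w : (forall k, k \in K -> b k = 0) ->
  has [predC K] w -> exists2 a, a \notin K & (a, p) \in trace b p w.
Proof.
move=> K0; elim: w p => //= a w IH p; have [aK /= /IH wK|aK _] := boolP (a \in K).
  have [a' a'K e] := wK (p + b a); exists a' => //.
  by rewrite inE; move: e; rewrite (K0 _ aK) addr0 => ->; rewrite orbT.
by exists a; rewrite // inE eqxx.
Qed.

Lemma mem_trace_split p w a q : (a, q) \in trace b p w ->
  exists u v, w = u ++ a :: v /\ q = p + \sum_(c <- u) b c.
Proof.
elim: w p => //= c w IH p; rewrite inE => /orP[/eqP[-> ->]|/IH[u [v [-> ->]]]].
  by exists [::], w; rewrite big_nil addr0.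
by exists (c :: u), v; rewrite big_cons addrA.
Qed.

(** For the last clause, a letter of [K] read at [p] shares its position with the next letter
    outside [K]. If none follows, the walk has already reached its end 0, where the first letter
    outside [K] was read. *)
Lemma word_content (K : {set A}) (d : nat) (w : seq A) (a0 : A) :
    (forall k, k \in K -> b k = 0) -> (forall a, (d %| b a)%Z) -> a0 \notin K ->
    (forall a, a \in w) -> wprod (gen y b) w = 1%g ->
  exists F : A -> laurent,
    [/\ forall a, nat_laurent_nz d (F a), \sum_a F a * y a = 0,
        \sum_a F a * (1 - lX (b a)) = 0 &
        forall k p, k \in K -> 0 < (F k)@_p ->
          exists2 a, a \notin K & 0 < (F a)@_p].
Proof.
move=> K0 bd a0K wA /wprod_eq1[w1 w2]; exists (content (trace b 0 w)).
have mem_d a p : (a, p) \in trace b 0 w -> (d %| p)%Z.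
  move=> /mem_trace_split[u [v [_ ->]]]; rewrite add0r.
  by apply: rpred_sum => c _; exact: bd.
split.
- move=> a; split.
  + have : a \in map fst (trace b 0 w) by rewrite map_fst_trace.
    case/mapP=> -[a' p] /= ap e; apply: (@lpos_neq0 _ p).
    by rewrite content_gt0 e.
  + by move=> k; rewrite content_coef ler0n.
  + move=> k; rewrite -mcoeff_neq0 => kN; apply: (mem_d a).
    by rewrite -content_gt0 lt_def kN content_coef ler0n.
- by rewrite -content_sum.
- by rewrite -content_sum trace_telescope w2 addr0 subrr.
move=> k p kK; rewrite content_gt0 => kp.
suff [a aK ap] : exists2 a, a \notin K & (a, p) \in trace b 0 w.
  by exists a; rewrite ?content_gt0.
have [u [v [w_def p_def]]] := mem_trace_split kp.
have w_cat : trace b 0 w = trace b 0 u ++ (k, p) :: trace b p v.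
  by rewrite w_def trace_cat /= -p_def (K0 _ kK) addr0.
have [/(trace_nonK p K0)[a aK ap]|vK] := boolP (has [predC K] v).
  by exists a; rewrite // w_cat mem_cat inE ap !orbT.
(* The letters after this one do not move, so [p] is the total displacement of the word. *)
have p0 : p = 0.
  move: w2; rewrite w_def big_cat big_cons /= (K0 _ kK) add0r.
  have -> : \sum_(c <- v) b c = 0.
    rewrite big_seq big1 // => c cv; apply: K0.
    by move/hasPn: vK => /(_ _ cv); rewrite /= negbK.
  by rewrite addr0 p_def add0r.
have [|a aK ap] := @trace_nonK K 0 u K0.
  apply/hasP; exists a0 => //; have := wA a0; rewrite w_def mem_cat inE.
  case/or3P=> // [/eqP e|a0v]; first by rewrite e kK in a0K.
  by move/hasPn: vK => /(_ _ a0v); rewrite /= a0K.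
by exists a; rewrite // p0 w_cat mem_cat ap.
Qed.

(** The family is realised as a list of edges and Euler's theorem is applied from 0. Every letter is
    used because no [F a] vanishes. *)
Lemma content_word (F : A -> laurent) :
    (forall a, lnonneg (F a)) -> (forall a, F a != 0) ->
    \sum_a F a * y a = 0 -> \sum_a F a * (1 - lX (b a)) = 0 ->
    (forall W : pred int, W 0 ->
       (forall a p, 0 < (F a)@_p -> W p = W (p + b a)) ->
       forall a p, 0 < (F a)@_p -> W p) ->
  exists2 w, (forall a, a \in w) & wprod (gen y b) w = 1%g.
Proof.
move=> F0 FN0 Fy Fb conn; have [E EF] := content_exists F0.
have [x||s ws sE] := @euler_circuit _ _ (@esrc A) (etgt b) E 0.
- have : \sum_(e <- E) lX e.2 * (1 - lX (b e.1)) = 0.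
    by rewrite (content_sum E (fun a => 1 - lX (b a))) -[RHS]Fb; apply: eq_bigr => a _; rewrite EF.
  (* The coefficient at [x] of the balance equation is the outdegree minus the indegree of [x]. *)
  under eq_bigr do rewrite mulrBr mulr1 -lXD.
  rewrite sumrB => /subr0_eq /(congr1 (fun f : laurent => f@_x)).
  by rewrite !lcoef_sumX => /eqP; rewrite eqr_nat => /eqP.
- move=> W W0 Wstable [a p] aE; apply: (conn W W0 _ a p); last by rewrite -EF content_gt0.
  by move=> a' p'; rewrite -EF content_gt0 => /Wstable.
have [s_def s0] := walkE ws; exists (map fst s).
  move=> a; have [p] := lnonneg_gt0P (F0 a) (FN0 a).
  rewrite -EF content_gt0 -(perm_mem sE) => /(map_f fst); exact.
apply/wprod_eq1; rewrite -s_def; split; last by rewrite {2}s0 add0r.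
by rewrite (perm_big _ sE) content_sum -[RHS]Fy; apply: eq_bigr => a _; rewrite EF.
Qed.

End Content.

(** * Positivity, degrees and transport *)

Lemma lmulIf h f g : h != 0 :> laurent -> f * h = g * h -> f = g.
Proof.
move=> h0 /(congr1 toQX); rewrite !rmorphM => e; apply: toQX_inj.
apply: mulIf e; apply: contraNneq h0 => h0.
by apply/eqP/toQX_inj; rewrite h0 raddf0.
Qed.

Lemma lnonneg_sum (T : Type) (r : seq T) (p : pred T) (F : T -> laurent) :
  (forall i, p i -> lnonneg (F i)) -> lnonneg (\sum_(i <- r | p i) F i).
Proof. by move=> F0 k; rewrite lcoef_sum sumr_ge0 // => i /F0. Qed.

Lemma lnonnegX i : lnonneg (lX i).
Proof. by move=> k; rewrite lcoefX ler0n. Qed.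

Lemma lnonnegM f g : lnonneg f -> lnonneg g -> lnonneg (f * g).
Proof. by move=> f0 g0 k; rewrite lcoefM sumr_ge0 // => i _; rewrite mulr_ge0. Qed.

Lemma lpos_sum (T : finType) (p : pred T) (F : T -> laurent) k :
  (forall i, p i -> lnonneg (F i)) ->
  0 < (\sum_(i | p i) F i)@_k <-> exists2 i, p i & 0 < (F i)@_k.
Proof.
move=> F0; rewrite lcoef_sum; split=> [|[i pi Fi]].
  rewrite lt_def => /andP[N0 _].
  have [/existsP[i /andP[pi Fi]]|] := boolP [exists i, p i && (0 < (F i)@_k)].
    by exists i.
  rewrite negb_exists => /forallP none; case/eqP: N0; apply: big1 => i pi.
  have := none i; rewrite pi /= lt_def (F0 i pi) andbT negbK => /eqP //.
rewrite (bigD1 i) //= ltr_pwDl // sumr_ge0 // => j /andP[/F0 Fj _]; exact: Fj.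
Qed.

(** Non-negative coefficients cannot cancel, so the support of a product is the sum of the
    supports. *)
Lemma lposM f g k : lnonneg f -> lnonneg g ->
  0 < (f * g)@_k <-> exists2 i, 0 < f@_i & 0 < g@_(k - i).
Proof.
move=> f0 g0; rewrite lcoefM; split=> [|[i fi gi]].
  rewrite lt_def => /andP[N0 _].
  have [/hasP[i _ /andP[fi gi]]|none] :=
      boolP (has (fun i => (0 < f@_i) && (0 < g@_(k - i))) (msupp f)).
    by exists i.
  case/eqP: N0; rewrite big_seq big1 // => i /(hasPn none).
  rewrite !lt_def f0 g0 !andbT negb_and !negbK.
  by case/orP=> /eqP->; rewrite ?mul0r ?mulr0.
have i_f : i \in msupp f by rewrite -mcoeff_neq0 gt_eqF.
rewrite (big_rem i) //= ltr_pwDl ?mulr_gt0 // sumr_ge0 // => j _.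
by rewrite mulr_ge0.
Qed.

Lemma lposMD f g i j : lnonneg f -> lnonneg g ->
  0 < f@_i -> 0 < g@_j -> 0 < (f * g)@_(i + j).
Proof.
by move=> f0 g0 fi gj; apply/lposM => //; exists i; rewrite // addrC addKr.
Qed.

Section NatLaurent.
Variable d : nat.

Lemma nat_laurentP f : nat_laurent_nz d f <->
  [/\ lnonneg f, exists k, 0 < f@_k & forall k, 0 < f@_k -> (d %| k)%Z].
Proof.
split=> [[fN0 f0 fd]|[f0 [k fk] fd]]; split=> //.
- exact: lnonneg_gt0P.
- by move=> k fk; apply: fd; rewrite -mcoeff_neq0 gt_eqF.
- exact: lpos_neq0 fk.
- by move=> i; rewrite -mcoeff_neq0 => fi; apply: fd; rewrite lt_def fi f0.
Qed.

Lemma nat_laurentM f g : nat_laurent_nz d f -> nat_laurent_nz d g ->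
  nat_laurent_nz d (f * g).
Proof.
move=> /nat_laurentP[f0 [i fi] fd] /nat_laurentP[g0 [j gj] gd].
apply/nat_laurentP; split; first exact: lnonnegM.
  by exists (i + j); apply: lposMD.
move=> k /lposM[] // l /fd dl /gd dk.
by rewrite -(subrK l k) rpredD.
Qed.

Lemma nat_laurentX k : (d %| k)%Z -> nat_laurent_nz d (lX k).
Proof.
move=> dk; apply/nat_laurentP; split; first exact: lnonnegX.
  by exists k; rewrite lcoefX eqxx.
by move=> i; rewrite lcoefX; case: eqP => // <-.
Qed.

Lemma nat_laurent_prod (T : Type) (r : seq T) (p : pred T) (F : T -> laurent) :
  (forall i, p i -> nat_laurent_nz d (F i)) ->
  nat_laurent_nz d (\prod_(i <- r | p i) F i).
Proof.
move=> F0; elim/big_rec: _ => [|i f /F0 Fi f0]; last exact: nat_laurentM.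
by apply: nat_laurentX; rewrite dvdz0.
Qed.

Lemma nat_laurent_sum (T : finType) (p : pred T) (F : T -> laurent) :
  (exists i, p i) -> (forall i, p i -> nat_laurent_nz d (F i)) ->
  nat_laurent_nz d (\sum_(i | p i) F i).
Proof.
move=> [i0 pi0] F0.
have Fnn i : p i -> lnonneg (F i) by case/F0.
apply/nat_laurentP; split; first exact: lnonneg_sum.
  have /nat_laurentP[_ [k Fk] _] := F0 _ pi0.
  by exists k; apply/lpos_sum => //; exists i0.
by move=> k /(lpos_sum _ Fnn)[i /F0/nat_laurentP[_ _ Fd] /Fd].
Qed.

End NatLaurent.

(** * Degrees through supports *)

Lemma degp_ge f p : p \in msupp f -> (p%:E <= degp f)%E.
Proof. by move=> pf; rewrite /degp (big_rem p) //= le_max lexx. Qed.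

Lemma degm_le f p : p \in msupp f -> (degm f <= p%:E)%E.
Proof. by move=> pf; rewrite /degm (big_rem p) //= ge_min lexx. Qed.

Lemma degp_attained f :
  degp f = -oo%E \/ exists2 q, q \in msupp f & degp f = q%:E.
Proof.
suff main (s : seq int) : \big[Order.max/-oo%E]_(k <- s) k%:E = -oo%E \/
    exists2 q, q \in s & \big[Order.max/-oo%E]_(k <- s) k%:E = q%:E by exact: main.
elim: s => [|x s [IH|[q qs IH]]].
- by left; rewrite big_nil.
- right; exists x; rewrite ?mem_head // big_cons IH; apply/max_idPl.
  exact: leNye.
rewrite big_cons IH; right; case: (leP x%:E%E q%:E%E) => _.
  by exists q; rewrite // inE qs orbT.
by exists x; rewrite ?mem_head.
Qed.

Lemma degm_attained f :
  degm f = +oo%E \/ exists2 q, q \in msupp f & degm f = q%:E.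
Proof.
suff main (s : seq int) : \big[Order.min/+oo%E]_(k <- s) k%:E = +oo%E \/
    exists2 q, q \in s & \big[Order.min/+oo%E]_(k <- s) k%:E = q%:E by exact: main.
elim: s => [|x s [IH|[q qs IH]]].
- by left; rewrite big_nil.
- right; exists x; rewrite ?mem_head // big_cons IH; apply/min_idPl.
  exact: leey.
rewrite big_cons IH; right; case: (leP x%:E%E q%:E%E) => _.
  by exists x; rewrite ?mem_head.
by exists q; rewrite // inE qs orbT.
Qed.

(** The convention for the degree of 0 agrees with the quantifiers: for [f = 0] both sides hold, and
    for [g = 0] with [f != 0] both fail. *)
Lemma degp_leDP f g c : lnonneg f -> lnonneg g ->
  (degp f <= degp g + c%:E)%E <->
  forall p, 0 < f@_p -> exists2 q, 0 < g@_q & p <= q + c.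
Proof.
move=> f0 g0; split=> [le_fg p fp|fg].
  have pf : p \in msupp f by rewrite -mcoeff_neq0 gt_eqF.
  have := le_trans (degp_ge pf) le_fg.
  have [->|[q qg ->]] := degp_attained g; first by [].
  rewrite -EFinD lee_fin => pq; exists q => //.
  by rewrite lt_def mcoeff_neq0 qg g0.
have [->|[p pf ->]] := degp_attained f; first exact: leNye.
have [|q gq pq] := fg p; first by rewrite lt_def mcoeff_neq0 pf f0.
apply: (@le_trans _ _ (q + c)%:E%E); first by rewrite lee_fin.
by rewrite EFinD leeD2r // degp_ge // -mcoeff_neq0 gt_eqF.
Qed.

Lemma degm_leP f g : lnonneg f -> lnonneg g ->
  (degm g <= degm f)%E <->
  forall p, 0 < f@_p -> exists2 q, 0 < g@_q & q <= p.
Proof.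
move=> f0 g0; split=> [le_gf p fp|fg].
  have pf : p \in msupp f by rewrite -mcoeff_neq0 gt_eqF.
  have := le_trans le_gf (degm_le pf).
  have [->|[q qg ->]] := degm_attained g; first by [].
  rewrite lee_fin => pq; exists q => //.
  by rewrite lt_def mcoeff_neq0 qg g0.
have [->|[p pf ->]] := degm_attained f; first exact: leey.
have [|q gq pq] := fg p; first by rewrite lt_def mcoeff_neq0 pf f0.
apply: (@le_trans _ _ q%:E%E); last by rewrite lee_fin.
by apply: degm_le; rewrite -mcoeff_neq0 gt_eqF.
Qed.

(** * Non-negative matrices with prescribed margins *)

Section Transport.
Variable A : finType.
Implicit Types (r c : A -> laurent) (s t : seq (A * int)).

Lemma content_cons e s (a : A) :
  content (e :: s) a = (if e.1 == a then lX e.2 else 0) + content s a.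
Proof. by rewrite /content big_cons; case: ifP; rewrite ?add0r. Qed.

Lemma content_perm s t (a : A) : perm_eq s t -> content s a = content t a.
Proof. exact: perm_big. Qed.

Lemma content_total s : \sum_(a : A) content s a = \sum_(e <- s) lX e.2.
Proof.
have := content_sum s (fun=> 1 : laurent).
by under eq_bigr do rewrite mulr1; move=> ->; under [RHS]eq_bigr do rewrite mulr1.
Qed.

(** Each entry [(a, p)] of [s] is matched with an entry [(b, p)] of [t] of the same exponent, and
    the match adds [X^p] to the matrix entry at [(a, b)]. *)
Lemma seq_transport s t : perm_eq (map snd s) (map snd t) ->
  exists m : A -> A -> laurent, [/\ forall i j, lnonneg (m i j),
    forall i, \sum_j m i j = content s i & forall j, \sum_i m i j = content t j].
Proof.
elim: s t => [|[a p] s IH] t.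
  rewrite perm_sym => /perm_nilP; case: t => //= _; exists (fun _ _ => 0).
  by split=> [i j k|i|j]; rewrite ?lcoef0 // /content big_nil big1.
move=> /= st; have : p \in map snd t by rewrite -(perm_mem st) mem_head.
case/mapP=> -[b p'] bt /= p_def; move: bt; rewrite -p_def => bt {p' p_def}.
have t_bt := perm_to_rem bt.
have [|m [m0 mr mc]] := IH (rem (b, p) t).
  by rewrite -(perm_cons p) (perm_trans st) // (perm_map snd t_bt).
exists (fun i j => (if (a == i) && (b == j) then lX p else 0) + m i j); split.
- by move=> i j k; rewrite lcoefD addr_ge0 ?m0 //; case: ifP; rewrite ?lcoef0 ?lnonnegX.
- move=> i; rewrite big_split /= mr content_cons /=; congr (_ + _).
  case: eqP => _ /=; last by rewrite big1.
  by rewrite -big_mkcond /= (big_pred1 b) // => j; rewrite eq_sym.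
- move=> j; rewrite big_split /= mc (content_perm j t_bt) content_cons /=; congr (_ + _).
  case: (b == j); last by rewrite big1 // => i _; rewrite andbF.
  by under eq_bigr do rewrite andbT; rewrite -big_mkcond /= (big_pred1 a) // => i; rewrite eq_sym.
Qed.

(** Both families are written as lists of monomials; equality of the totals says that the two lists
    have the same exponents with multiplicity, so they can be matched. *)
Lemma transport r c :
    (forall i, lnonneg (r i)) -> (forall j, lnonneg (c j)) ->
    \sum_i r i = \sum_j c j ->
  exists m : A -> A -> laurent, [/\ forall i j, lnonneg (m i j),
    forall i, \sum_j m i j = r i & forall j, \sum_i m i j = c j].
Proof.
move=> /content_exists[s sr] /content_exists[t tc] e_rc.
have [|m [m0 mr mc]] := @seq_transport s t; last first.
  by exists m; split=> // [i|j]; rewrite ?mr ?mc.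
apply/allP => k _ /=; rewrite !count_map.
move: e_rc; under eq_bigr do rewrite -sr; under [RHS]eq_bigr do rewrite -tc.
rewrite !content_total => /(congr1 (fun f : laurent => f@_k)).
by rewrite !lcoef_sumX => /eqP; rewrite eqr_nat.
Qed.

End Transport.

(** * From a word to the pairs *)

Section Den.
Variable d : nat.
Hypothesis d_gt0 : (0 < d)%N.

(* Up to sign, the quotient of [1 - X^c] by [1 - X^d]. *)
Definition den (c : int) : laurent :=
  if 0 < c then \sum_(0 <= k < `|c|%N %/ d) lX (d * k)%N
  else \sum_(1 <= k < (`|c|%N %/ d).+1) lX (- (d * k)%N%:Z).

Lemma den0 : den 0 = 0.
Proof. by rewrite /den ltxx absz0 div0n big_geq. Qed.

(** A geometric sum in [X^d] or in [X^(-d)], by induction on the number of terms; at [c = 0] both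
    sides vanish. *)
Lemma den_telescope c : (d %| c)%Z ->
  1 - lX c = (-1) ^+ (c <= 0)%R * den c * (1 - lX d).
Proof.
move=> dc; have c_abs : (`|c|%N %/ d * d)%N = `|c|%N by rewrite divnK.
rewrite /den [0 < c]ltNge; have [c0|c0] /= := lerP c 0.
  rewrite -[c in LHS]opprK expr1 mulN1r mulNr -[LHS]opprB; congr (- _).
  have <- : (d * (`|c|%N %/ d))%N = - c :> int by lia.
  elim: (_ %/ d)%N => [|n IH]; first by rewrite big_geq // muln0 oppr0 lX0 subrr mul0r.
  rewrite big_nat_recr //= mulrDl -IH mulrBr mulr1 -lXD.
  have -> : - (d * n.+1)%N%:Z + d%:Z = - (d * n)%N%:Z by lia.
  by rewrite [RHS]addrC addrA subrK.
rewrite expr0 mul1r; have {1}-> : c = (d * (`|c|%N %/ d))%N by lia.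
elim: (_ %/ d)%N => [|n IH]; first by rewrite big_geq // muln0 lX0 subrr mul0r.
rewrite big_nat_recr //= mulrDl -IH mulrBr mulr1 -lXD.
have -> : (d * n)%N%:Z + d%:Z = (d * n.+1)%N by lia.
by rewrite addrA subrK.
Qed.

(** A gap is indexed by its left end. From position [p] an upward letter first crosses the gap at
    [p], a downward one the gap at [p - d]; hence the [d] in the condition on [degp] and its absence
    from the one on [degm]. *)
Lemma den_pos_coef c e : 0 < c -> 0 < (den c)@_e -> 0 <= e.
Proof.
move=> c0; rewrite /den c0 lcoef_sumX ltr0n -has_count => /hasP[k _ /eqP<-] //.
Qed.

Lemma den_neg_coef c e : c < 0 -> 0 < (den c)@_e -> e <= - d%:Z.
Proof.
move=> c0; rewrite /den [0 < c]ltNge (ltW c0) /= lcoef_sumX ltr0n -has_count.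
by case/hasP=> k; rewrite mem_index_iota => k1 /eqP<-; nia.
Qed.

Lemma den_pos_coef0 c : (d %| c)%Z -> 0 < c -> 0 < (den c)@_0.
Proof.
move=> dc c0; rewrite /den c0 lcoef_sumX ltr0n -has_count; apply/hasP.
exists 0%N; rewrite ?muln0 // mem_index_iota /= divn_gt0 // dvdn_leq //; lia.
Qed.

Lemma den_neg_coefd c : (d %| c)%Z -> c < 0 -> 0 < (den c)@_(- d%:Z).
Proof.
move=> dc c0; rewrite /den [0 < c]ltNge (ltW c0) /= lcoef_sumX ltr0n -has_count.
apply/hasP; exists 1%N; rewrite ?muln1 // mem_index_iota /= ltnS divn_gt0 //.
by rewrite dvdn_leq //; lia.
Qed.

Lemma den_nat c : (d %| c)%Z -> c != 0 -> nat_laurent_nz d (den c).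
Proof.
move=> dc c_neq0; apply/nat_laurentP; split.
- by rewrite /den; case: ifP => _; apply: lnonneg_sum => i _; apply: lnonnegX.
- by case: (ltgtP c 0) c_neq0 => // c0 _; [exists (- d%:Z)|exists 0];
    [apply: den_neg_coefd|apply: den_pos_coef0].
move=> k; rewrite /den; case: ifP => _; rewrite lcoef_sumX ltr0n -has_count.
  by case/hasP=> i _ /eqP<-; rewrite PoszM dvdz_mulr.
by case/hasP=> i _ /eqP<-; rewrite rpredN PoszM dvdz_mulr.
Qed.

Lemma toQX_den_pos c : 0 < c ->
  toQX (den c) = \sum_(0 <= k < `|c|%N %/ d) qX ^+ (d * k).
Proof.
by move=> c0; rewrite /den c0 raddf_sum; apply: eq_bigr => k _; rewrite /= toQXX.
Qed.

Lemma toQX_den_neg c : c < 0 ->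
  toQX (den c) = \sum_(1 <= k < (`|c|%N %/ d).+1) qX ^- (d * k).
Proof.
move=> c0; rewrite /den [0 < c]ltNge (ltW c0) raddf_sum; apply: eq_bigr => k _.
by rewrite /= toQXX exprnN.
Qed.

Lemma toQX_den_neq0 c : (d %| c)%Z -> c != 0 -> toQX (den c) != 0.
Proof.
move=> dc c0; have [dN0 _ _] := den_nat dc c0; apply: contraNneq dN0.
by rewrite -(raddf0 toQX) => /toQX_inj->.
Qed.

Lemma one_subX_neq0 : 1 - lX d != 0.
Proof.
rewrite subr_eq0; apply/eqP => /(congr1 (fun f : laurent => f@_0)).
by rewrite -lX0 !lcoefX eqxx; case: eqP => //; lia.
Qed.

End Den.

(** * Row and column sums of the pairs *)

Section Margins.
Variables (A : finType) (S : {set A * A}) (f : A * A -> laurent).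

Definition rowsum (i : A) : laurent := \sum_(p in S | p.1 == i) f p.
Definition colsum (j : A) : laurent := \sum_(p in S | p.2 == j) f p.

Lemma rowsum_total (I : {set A}) (h : A -> QX) : {in S, forall p, p.1 \in I} ->
  \sum_(p in S) toQX (f p) * h p.1 = \sum_(i in I) toQX (rowsum i) * h i.
Proof.
move=> SI; rewrite (partition_big (fun p => p.1) (mem I)) //=.
apply: eq_bigr => i _; rewrite raddf_sum mulr_suml; apply: eq_bigr => p.
by case/andP=> _ /eqP->.
Qed.

Lemma colsum_total (J : {set A}) (h : A -> QX) : {in S, forall p, p.2 \in J} ->
  \sum_(p in S) toQX (f p) * h p.2 = \sum_(j in J) toQX (colsum j) * h j.
Proof.
move=> SJ; rewrite (partition_big (fun p => p.2) (mem J)) //=.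
apply: eq_bigr => i _; rewrite raddf_sum mulr_suml; apply: eq_bigr => p.
by case/andP=> _ /eqP->.
Qed.

Lemma rowsum_sum (I : {set A}) : {in S, forall p, p.1 \in I} ->
  \sum_(p in S) f p = \sum_(i in I) rowsum i.
Proof. by move=> SI; rewrite (partition_big (fun p => p.1) (mem I)). Qed.

Lemma colsum_sum (J : {set A}) : {in S, forall p, p.2 \in J} ->
  \sum_(p in S) f p = \sum_(j in J) colsum j.
Proof. by move=> SJ; rewrite (partition_big (fun p => p.2) (mem J)). Qed.

(** Each summand of [h_pair] depends on one component of the pair only, so [f] enters only through
    its margins. *)
Lemma h_pair_sum (y : A -> laurent) (b : A -> int) (d : nat) :
    S \subset setX [set a | 0 < b a] [set a | b a < 0] ->
  \sum_(p in S) toQX (f p) * h_pair y b d p =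
    \sum_(i | 0 < b i) toQX (rowsum i) * (toQX (y i) / toQX (den d (b i)))
  + \sum_(j | b j < 0) toQX (colsum j) * (toQX (y j) / toQX (den d (b j))).
Proof.
move=> /subsetP SIJ; pose h a := toQX (y a) / toQX (den d (b a)).
have SI : {in S, forall p, p.1 \in [set a | 0 < b a]}.
  by move=> [i j] /SIJ; rewrite in_setX => /andP[].
have SJ : {in S, forall p, p.2 \in [set a | b a < 0]}.
  by move=> [i j] /SIJ; rewrite in_setX => /andP[].
transitivity (\sum_(p in S) (toQX (f p) * h p.1 + toQX (f p) * h p.2)).
  apply: eq_bigr => -[i j] ij; rewrite /= -mulrDr /h.
  have := SI _ ij; have := SJ _ ij; rewrite !inE /= => bj bi.
  by rewrite toQX_den_pos // toQX_den_neg.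
rewrite big_split /= (rowsum_total h SI) (colsum_total h SJ).
by congr (_ + _); apply: eq_bigl => a; rewrite inE.
Qed.

End Margins.

Lemma sum_by_sign (A : finType) (b : A -> int) (V : nmodType) (G : A -> V) :
  \sum_a G a =
    \sum_(a | 0 < b a) G a + \sum_(a | b a < 0) G a + \sum_(a | b a == 0) G a.
Proof.
rewrite (bigID (fun a => 0 < b a)) /= -addrA; congr (_ + _).
by rewrite (bigID (fun a => b a < 0)) /=; congr (_ + _); apply: eq_bigl => a; case: ltgtP.
Qed.

Section Forward.
Variables (A : finType) (y : A -> laurent) (b : A -> int) (d : nat).
Hypotheses (d_gt0 : (0 < d)%N) (db : forall a, (d %| b a)%Z).

(** Every gap is crossed equally often upwards and downwards: this is the balance equation divided
    by [1 - X^d]. *)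
Lemma margins_of_balance (F : A -> laurent) :
    \sum_a F a * (1 - lX (b a)) = 0 ->
  \sum_(a | 0 < b a) F a * den d (b a) = \sum_(a | b a < 0) F a * den d (b a).
Proof.
move=> bal; apply: (lmulIf (one_subX_neq0 d_gt0)).
move: bal; under eq_bigr do rewrite (den_telescope d_gt0 (db _)).
rewrite (sum_by_sign b) [X in _ + X = _]big1 ?addr0 => [|a /eqP->]; last first.
  by rewrite den0 mulr0 mul0r mulr0.
have e1 : \sum_(a | 0 < b a) F a * ((-1) ^+ (b a <= 0)%R * den d (b a) * (1 - lX d))
    = (\sum_(a | 0 < b a) F a * den d (b a)) * (1 - lX d).
  rewrite mulr_suml; apply: eq_bigr => a ba.
  by rewrite leNgt ba mul1r mulrA.
have e2 : \sum_(a | b a < 0) F a * ((-1) ^+ (b a <= 0)%R * den d (b a) * (1 - lX d))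
    = - ((\sum_(a | b a < 0) F a * den d (b a)) * (1 - lX d)).
  rewrite mulr_suml -sumrN; apply: eq_bigr => a ba.
  by rewrite (ltW ba) mulN1r mulNr mulrN mulrA.
by rewrite e1 e2 => /subr0_eq.
Qed.

(** The pairs are the entries of a transport matrix with margins [F a * den d (b a)], and [S] is its
    set of non-zero entries. It is double-full because these margins are non-zero. *)
Lemma pairs_of_contents (F : A -> laurent) (I J K : {set A})
    (defI : I = [set a | 0 < b a]) (defJ : J = [set a | b a < 0])
    (defK : K = [set a | b a == 0]) :
    (forall a, nat_laurent_nz d (F a)) ->
    \sum_a F a * y a = 0 -> \sum_a F a * (1 - lX (b a)) = 0 ->
    (forall k p, k \in K -> 0 < (F k)@_p ->
       exists2 a, a \notin K & 0 < (F a)@_p) ->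
  exists (S : {set A * A}) (f : A * A -> laurent),
    [/\ double_full I J S & forall p, p \in S -> nat_laurent_nz d (f p)] /\
    [/\ \sum_(p in S) toQX (f p) * h_pair y b d p
          + \sum_(k in K) toQX (F k) * toQX (y k) = 0,
        (degp (\sum_(k in K) F k)%R
           <= degp (\sum_(p in S) f p)%R + d%:Z%:E)%E
      & (degm (\sum_(p in S) f p)%R <= degm (\sum_(k in K) F k)%R)%E].
Proof.
move=> F_nat Fy Fb FK.
have FnatT a : b a != 0 -> nat_laurent_nz d (F a * den d (b a)).
  by move=> ba; apply: nat_laurentM => //; exact: den_nat.
have den_nn a : b a != 0 -> lnonneg (den d (b a)).
  by move=> ba; case: (den_nat d_gt0 (db a) ba).
have Fnn a : lnonneg (F a) by case: (F_nat a).
(* Extending the margins by 0 to all of [A] confines the matrix to [I] times [J]. *)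
pose r a := if 0 < b a then F a * den d (b a) else 0.
pose c a := if b a < 0 then F a * den d (b a) else 0.
have r0 a : lnonneg (r a).
  by rewrite /r; case: ifP => [/gt_eqF/negbT/FnatT[]//|_ k]; rewrite lcoef0.
have c0 a : lnonneg (c a).
  by rewrite /c; case: ifP => [/lt_eqF/negbT/FnatT[]//|_ k]; rewrite lcoef0.
have rc : \sum_a r a = \sum_a c a by rewrite -!big_mkcond margins_of_balance.
have [m [m0 mr mc]] := transport r0 c0 rc.
have mr_le i j k : 0 < (m i j)@_k -> 0 < (r i)@_k.
  by move=> mk; rewrite -mr; apply/lpos_sum => //; exists j.
have mc_le i j k : 0 < (m i j)@_k -> 0 < (c j)@_k.
  by move=> mk; rewrite -mc; apply/lpos_sum => //; exists i.
have m_neq0 i j : m i j != 0 -> 0 < b i /\ b j < 0.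
  move=> /(lnonneg_gt0P (m0 i j))[k mk]; move: (mr_le _ _ _ mk) (mc_le _ _ _ mk).
  by rewrite /r /c; case: ifP; case: ifP; rewrite ?lcoef0.
pose S := [set p : A * A | m p.1 p.2 != 0]; pose f p := m p.1 p.2.
have SIJ : S \subset setX [set a | 0 < b a] [set a | b a < 0].
  by apply/subsetP=> -[i j]; rewrite !inE /= => /m_neq0[-> ->].
have rowE i : rowsum S f i = r i.
  rewrite -mr /rowsum big_mkcond /= /S.
  transitivity (\sum_(p : A * A) if p.1 == i then m p.1 p.2 else 0).
    apply: eq_bigr => p _; rewrite inE; case: (p.1 == i); rewrite ?andbT ?andbF //.
    by case: eqP => [->|].
  rewrite -(pair_bigA _ (fun i' j => if i' == i then m i' j else 0)) /=.
  rewrite (bigD1 i) //= eqxx [X in _ + X]big1 ?addr0 // => i' /negbTE->.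
  by rewrite big1.
have colE j : colsum S f j = c j.
  rewrite -mc /colsum big_mkcond /= /S.
  transitivity (\sum_(p : A * A) if p.2 == j then m p.1 p.2 else 0).
    apply: eq_bigr => p _; rewrite inE; case: (p.2 == j); rewrite ?andbT ?andbF //.
    by case: eqP => [->|].
  rewrite -(pair_bigA _ (fun i j' => if j' == j then m i j' else 0)) /=.
  apply: eq_bigr => i _; rewrite (bigD1 j) //= eqxx [X in _ + X]big1 ?addr0 // => j' /negbTE-> //.
have totE : \sum_(p in S) f p = \sum_a r a.
  rewrite (@rowsum_sum _ _ _ [set: A]) //; apply: eq_big => a; rewrite ?inE ?rowE //.
have tot0 : lnonneg (\sum_a r a) by apply: lnonneg_sum.
have FKnn : lnonneg (\sum_(k in K) F k) by apply: lnonneg_sum.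
(* The letter outside [K] read at [p] crosses the gap at [p] if it goes up, and the gap at [p - d]
   if it goes down. *)
have cover p : 0 < (\sum_(k in K) F k)@_p ->
    0 < (\sum_a r a)@_p \/ 0 < (\sum_a r a)@_(p - d%:Z).
  move=> /lpos_sum[] // k kK /(FK _ _ kK)[a]; rewrite defK inE => ba ap.
  case: (ltgtP (b a) 0) ba => // ba _; [right; rewrite rc|left].
    apply/lpos_sum => //; exists a; rewrite // /c ba.
    by apply: lposMD => //; [exact: den_nn (negbT (lt_eqF ba))|exact: den_neg_coefd].
  apply/lpos_sum => //; exists a; rewrite // /r ba -[p]addr0.
  by apply: lposMD => //; [exact: den_nn (negbT (gt_eqF ba))|exact: den_pos_coef0].
exists S, f; split; split.
- rewrite defI defJ; split=> // [i|j]; rewrite inE => ba.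
    have /nat_laurentP[_ [k Tk] _] := FnatT _ (negbT (gt_eqF ba)); move: Tk.
    have <- : r i = F i * den d (b i) by rewrite /r ba.
    rewrite -mr => /lpos_sum[] // j _ mk; have mN0 := lpos_neq0 mk.
    by exists j; rewrite inE //; case: (m_neq0 _ _ mN0).
  have /nat_laurentP[_ [k Tk] _] := FnatT _ (negbT (lt_eqF ba)); move: Tk.
  have <- : c j = F j * den d (b j) by rewrite /c ba.
  rewrite -mc => /lpos_sum[] // i _ mk; have mN0 := lpos_neq0 mk.
  by exists i; rewrite inE //; case: (m_neq0 _ _ mN0).
- move=> [i j]; rewrite inE /= => mN0; apply/nat_laurentP.
  split; [exact: m0|exact: lnonneg_gt0P (m0 i j) mN0|].
  move=> k /mr_le; have [bi _] := m_neq0 _ _ mN0; rewrite /r bi.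
  by have /nat_laurentP[_ _] := FnatT _ (negbT (gt_eqF bi)); apply.
- rewrite h_pair_sum //.
  transitivity (toQX (\sum_a F a * y a)); last by rewrite Fy raddf0.
  rewrite raddf_sum (sum_by_sign b); congr (_ + _ + _).
  + apply: eq_bigr => a ba; rewrite rowE /r ba /= !rmorphM /=.
    have := toQX_den_neq0 d_gt0 (db a) (negbT (gt_eqF ba)).
    by move: (toQX (den _ _)) => D D0; rewrite mulrACA divff ?mulr1.
  + apply: eq_bigr => a ba; rewrite colE /c ba /= !rmorphM /=.
    have := toQX_den_neq0 d_gt0 (db a) (negbT (lt_eqF ba)).
    by move: (toQX (den _ _)) => D D0; rewrite mulrACA divff ?mulr1.
  + apply: eq_big => [a|a _]; last by rewrite /= rmorphM.
    by rewrite defK inE.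
- rewrite totE; apply/degp_leDP => // p /cover[] pr; last by exists (p - d%:Z); rewrite // subrK.
  by exists p; rewrite // lerDl.
- rewrite totE; apply/degm_leP => // p /cover[] pr; first by exists p.
  by exists (p - d%:Z); rewrite // lerBlDr lerDl.
Qed.

End Forward.

(** * Connectivity of large windows *)

(** By Bezout, the gcd lies in every subgroup of the integers containing all the [b a]. *)
Lemma biggcd_closed (T : finType) (X : pred T) (b : T -> int) (Q : int -> Prop) :
    Q 0 -> (forall u v, Q u -> Q v -> Q (u + v)) -> (forall u, Q u -> Q (- u)) ->
    (forall a, X a -> Q (b a)) ->
  Q (\big[gcdn/0%N]_(a | X a) `|b a|%N)%:Z.
Proof.
move=> Q0 QD QN Qb.
have QMn u n : Q u -> Q (u *+ n).
  by move=> Qu; elim: n => [|n IH]; rewrite ?mulr0n // mulrS; apply: QD.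
have QM c u : Q u -> Q (c * u).
  move=> Qu; rewrite mulrC -mulrzz; case: c => n; first by rewrite [_ *~ _]/(u *+ n); apply: QMn.
  by rewrite NegzE mulrNz; apply: QN; apply: QMn.
elim/big_rec: _ => // a g Xa Qg.
have [u [v e]] := Bezoutz (b a) g; rewrite [X in Q X](_ : _ = gcdz (b a) g) // -e.
by apply: QD; apply: QM => //; apply: Qb.
Qed.

Lemma support_bounded f : exists C : nat, forall e, 0 < f@_e -> `|e| <= C%:Z.
Proof.
exists (\max_(i <- msupp f) absz i)%N => e fe.
have ef : e \in msupp f by rewrite -mcoeff_neq0 gt_eqF.
suff : (absz e <= \max_(i <- msupp f) absz i)%N by lia.
by rewrite (big_rem e) //= leq_max leqnn.
Qed.

Section Window.
Variable d : nat.
Hypothesis d_gt0 : (0 < d)%N.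

Definition window (n : nat) : laurent :=
  \sum_(0 <= k < n.*2.+1) lX (d%:Z * (k%:Z - n%:Z)).

Lemma window_gt0 n e : (0 < (window n)@_e) = (d %| e)%Z && (`|e| <= (d * n)%N%:Z).
Proof.
rewrite lcoef_sumX ltr0n -has_count; apply/hasP/andP => [[k]|[/dvdzP[q ->] qn]].
  rewrite mem_index_iota => kn /eqP<-; rewrite dvdz_mulr // normrM; split=> //.
  rewrite PoszM ger0_norm // ler_pM2l //; lia.
exists (absz (q + n%:Z)); last first.
  by apply/eqP; rewrite mulrC; congr (_ * _); move: qn; rewrite normrM PoszM; nia.
by rewrite mem_index_iota; move: qn; rewrite normrM PoszM; nia.
Qed.

Lemma window_nat n : nat_laurent_nz d (window n).
Proof.
apply/nat_laurentP; split; first by apply: lnonneg_sum => k _; apply: lnonnegX.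
  by exists 0; rewrite window_gt0 dvdz0 normr0.
by move=> k; rewrite window_gt0 => /andP[].
Qed.

(** The product is supported on translates of the window by exponents of [P]. Two such exponents
    differ by at most [2C], which does not exceed the window's width [2dn], so no multiple of [d] is
    missed between two translates. *)
Lemma window_convex P (C n : nat) u v w :
    nat_laurent_nz d P -> (forall e, 0 < P@_e -> `|e| <= C%:Z) -> (C <= n)%N ->
    0 < (P * window n)@_u -> 0 < (P * window n)@_v ->
    u <= w <= v -> (d %| w)%Z ->
  0 < (P * window n)@_w.
Proof.
move=> /nat_laurentP[P0 _ Pd] PC Cn; have [_ w0 _] := window_nat n.
move=> /(lposM _ P0 w0)[e1 Pe1]; rewrite window_gt0 => /andP[_ un].
move=> /(lposM _ P0 w0)[e2 Pe2]; rewrite window_gt0 => /andP[_ vn] uwv dw.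
have dn : (n%:Z <= (d * n)%N%:Z) by rewrite lez_nat leq_pmull.
have [we1|we1] := lerP `|w - e1| (d * n)%N%:Z.
  by apply/lposM => //; exists e1; rewrite // window_gt0 we1 andbT rpredB // Pd.
have we2 : `|w - e2| <= (d * n)%N%:Z.
  by have := PC _ Pe1; have := PC _ Pe2; move: (d * n)%N un vn dn we1 => m; lia.
by apply/lposM => //; exists e2; rewrite // window_gt0 we2 andbT rpredB // Pd.
Qed.

(** A single translate suffices: [w] is at distance at most [L + C] from any exponent of [P]. *)
Lemma window_core P (C n L : nat) w :
    nat_laurent_nz d P -> (forall e, 0 < P@_e -> `|e| <= C%:Z) -> (C + L <= n)%N ->
    (d %| w)%Z -> `|w| <= L%:Z ->
  0 < (P * window n)@_w.
Proof.
move=> /nat_laurentP[P0 [e Pe] Pd] PC Cn dw wL; have [_ w0 _] := window_nat n.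
have dn : (n%:Z <= (d * n)%N%:Z) by rewrite lez_nat leq_pmull.
have dwe : (d %| w - e)%Z by rewrite rpredB // Pd.
apply/lposM => //; exists e; rewrite // window_gt0 dwe /=.
by have := PC _ Pe; move: (d * n)%N dn => m; lia.
Qed.

End Window.

Section Connectivity.
Variables (A : finType) (b : A -> int).
Variable d : nat.
Hypothesis d_gt0 : (0 < d)%N.
Let is_gcd := d = (\big[gcdn/0%N]_(a | b a != 0) `|b a|%N).

Lemma gcd_dvd a : is_gcd -> (d %| b a)%Z.
Proof.
move=> d_def.
have [->|ba] := eqVneq (b a) 0; first by rewrite dvdz0.
by rewrite dvdzE d_def (bigD1 a) //= dvdn_gcdl.
Qed.

(* [M] bounds the drift when the steps of a Bezout relation for [d] are performed
   one after the other. *)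
Lemma core_step : is_gcd -> exists M : nat, forall (L : int) (W : pred int),
    (forall a v, b a != 0 -> (d %| v)%Z -> `|v| <= L -> W v = W (v + b a)) ->
  forall v, (d %| v)%Z -> `|v| + M%:Z <= L -> W v = W (v + d%:Z).
Proof.
move=> d_def; have db := fun a => gcd_dvd a d_def.
(* The shifts [x] that preserve [W] at bounded distance from the border form a subgroup. *)
pose Q (x : int) := (d %| x)%Z /\ exists M : nat, forall (L : int) (W : pred int),
    (forall a v, b a != 0 -> (d %| v)%Z -> `|v| <= L -> W v = W (v + b a)) ->
  forall v, (d %| v)%Z -> `|v| + M%:Z <= L -> W v = W (v + x).
suff [] : Q d by [].
rewrite [X in Q (Posz X)]d_def {d_def}; apply: biggcd_closed => [|u v [du [M1 uP]] [dv [M2 vP]]|u [du [M uP]]|a ba].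
- by split; [rewrite dvdz0|exists 0%N => L W _ v _ _; rewrite addr0].
- split; first by rewrite rpredD.
  (* After the shift by [u] the position may be [absz u] further out, and room [M2] must remain. *)
  exists (M1 + absz u + M2)%N => L W WP x dx xL; rewrite addrA.
  rewrite (uP L W WP x dx); last by clear -xL; lia.
  by rewrite (vP L W WP (x + u) (rpredD dx du)) //; clear -xL; lia.
- split; first by rewrite rpredN.
  exists (M + absz u)%N => L W WP x dx xL.
  rewrite (uP L W WP (x - u) (rpredB dx du)) ?subrK //.
  by clear -xL; lia.
- split; first exact: db.
  by exists 0%N => L W WP v dv; rewrite addr0; apply: WP.
Qed.

(** Here [G a] stands for the support of [F a]. Steps of length [d] join 0 to all multiples of [d]
    of absolute value at most [B]; a vertex further out is brought closer to 0 by its own letter,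
    without leaving the interval [G a]. *)
Lemma window_connected : is_gcd -> exists L : nat, forall (G : A -> pred int) (W : pred int),
    (forall a p, G a p -> (d %| p)%Z) ->
    (forall a p, b a != 0 -> (d %| p)%Z -> `|p| <= L%:Z -> G a p) ->
    (forall a (u v w : int), b a != 0 -> G a u -> G a v -> u <= w <= v -> (d %| w)%Z -> G a w) ->
    W 0 -> (forall a p, b a != 0 -> G a p -> W p = W (p + b a)) ->
  forall a p, b a != 0 -> G a p -> W p.
Proof.
move=> d_def; have db := fun a => gcd_dvd a d_def.
have [M stepP] := core_step d_def; clear d_def.
have [B BP] : exists B : nat, forall a, `|b a| <= B%:Z.
  exists (\max_a absz (b a))%N => a.
  by have := @leq_bigmax A (fun c => absz (b c)) a; move: (\max_c _)%N => B; clear; lia.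
(* [M] is the room needed by [core_step], applied at positions up to [B + d]. *)
exists (M + B + d)%N => G W Gd Gcore Gconv W0 WG.
have step v : (d %| v)%Z -> `|v| <= (B + d)%N%:Z -> W v = W (v + d%:Z).
  move=> dv vB; apply: (stepP (M + B + d)%N); rewrite //; last by lia.
  by move=> a x ba dx xL; apply: WG => //; apply: Gcore.
have core v : (d %| v)%Z -> `|v| <= B%:Z -> W v.
  case/dvdzP=> q ->; elim/int_ind: q => [|n IH|n IH] qB; first by rewrite mul0r.
    have -> : n.+1%:Z * d%:Z = n%:Z * d%:Z + d%:Z by lia.
    by rewrite -step ?dvdz_mull // ?IH //; nia.
  rewrite step ?dvdz_mull //; last by lia.
  have -> : - n.+1%:Z * d%:Z + d%:Z = - n%:Z * d%:Z by lia.
  by apply: IH; nia.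
move=> a p ba; have [n] := ubnP (absz p); elim: n p => // n IH p pn Gp.
have [pB|pB] := lerP `|p| B%:Z; first exact: core (Gd _ _ Gp) pB.
have baB := BP a.
have G0 : G a 0 by apply: Gcore; rewrite ?dvdz0 ?normr0.
have dba := db a; have dp := Gd _ _ Gp.
(* The edge is followed backwards if [p] and [b a] have the same sign, forwards otherwise. As [b a]
   is non-zero and at most [B] in absolute value, the new vertex lies between 0 and [p], closer to
   0. *)
have [p0|p0] := lerP 0 p; have [ba0|ba0] := lerP 0 (b a).
- have Gq : G a (p - b a) by apply: Gconv G0 Gp _ _; rewrite ?rpredB //; lia.
  by rewrite -(subrK (b a) p) -WG // IH //; lia.
- have Gq : G a (p + b a) by apply: Gconv G0 Gp _ _; rewrite ?rpredD //; lia.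
  by rewrite (WG _ _ ba Gp) IH //; lia.
- have Gq : G a (p + b a) by apply: Gconv Gp G0 _ _; rewrite ?rpredD //; lia.
  by rewrite (WG _ _ ba Gp) IH //; lia.
- have Gq : G a (p - b a) by apply: Gconv Gp G0 _ _; rewrite ?rpredB //; lia.
  by rewrite -(subrK (b a) p) -WG // IH //; lia.
Qed.

End Connectivity.

(** * From the pairs to a word *)

(** Used with [T a], [R a], the window, [y a] and [den d (b a)], where [q * r] is the product of all
    denominators. *)
Lemma rescale_quotient (F : fieldType) (t r w z q : F) : q != 0 ->
  t * r * w * z = q * r * w * (t * (z / q)).
Proof. by move=> q0; field. Qed.

Section Backward.
Variables (A : finType) (y : A -> laurent) (b : A -> int) (d : nat).
Hypothesis d_gt0 : (0 < d)%N.
Hypothesis d_def : d = \big[gcdn/0%N]_(a | b a != 0) `|b a|%N.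

(** With [F a = T a * R a * w], the crossing polynomial [F a * den d (b a)] is [T a * (D * w)]. All
    data are thus scaled by the common factor [D * w], which preserves (i) and the balance. *)
Lemma contents_of_pairs (S : {set A * A}) (f : A * A -> laurent) (fK : A -> laurent)
    (I J K : {set A}) (defI : I = [set a | 0 < b a])
    (defJ : J = [set a | b a < 0]) (defK : K = [set a | b a == 0]) :
    double_full I J S ->
    (forall p, p \in S -> nat_laurent_nz d (f p)) ->
    (forall k, k \in K -> nat_laurent_nz d (fK k)) ->
    \sum_(p in S) toQX (f p) * h_pair y b d p
          + \sum_(k in K) toQX (fK k) * toQX (y k) = 0 ->
    (degp (\sum_(k in K) fK k)%R
           <= degp (\sum_(p in S) f p)%R + d%:Z%:E)%E ->
    (degm (\sum_(p in S) f p)%R <= degm (\sum_(k in K) fK k)%R)%E ->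
  exists F : A -> laurent,
    [/\ forall a, nat_laurent_nz d (F a), \sum_a F a * y a = 0,
        \sum_a F a * (1 - lX (b a)) = 0 &
        forall W : pred int, W 0 ->
          (forall a p, 0 < (F a)@_p -> W p = W (p + b a)) ->
          forall a p, 0 < (F a)@_p -> W p].
Proof.
move=> [SIJ Sfull1 Sfull2] f_nat fK_nat fh deg_p deg_m.
have db a : (d %| b a)%Z := gcd_dvd a d_def.
rewrite defI defJ in SIJ; have /subsetP SIJ' := SIJ.
pose T a := if 0 < b a then rowsum S f a else colsum S f a.
have T_nat a : b a != 0 -> nat_laurent_nz d (T a).
  rewrite /T; case: ltgtP => // ba _; apply: nat_laurent_sum.
  - have [|j _ aj] := Sfull1 a; first by rewrite defI inE.
    by exists (a, j); rewrite /= aj eqxx.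
  - by move=> p /andP[pS _]; apply: f_nat.
  - have [|i _ ia] := Sfull2 a; first by rewrite defJ inE.
    by exists (i, a); rewrite /= ia eqxx.
  - by move=> p /andP[pS _]; apply: f_nat.
pose R a := \prod_(c | (b c != 0) && (c != a)) den d (b c).
pose D := \prod_(c | b c != 0) den d (b c).
have DE a : b a != 0 -> D = den d (b a) * R a.
  by move=> ba; rewrite /D (bigD1 a).
have den_natb a : b a != 0 -> nat_laurent_nz d (den d (b a)) by move=> ba; apply: den_nat.
have R_nat a : nat_laurent_nz d (R a).
  by apply: nat_laurent_prod => c /andP[bc _]; apply: den_natb.
have D_nat : nat_laurent_nz d D by apply: nat_laurent_prod.
pose P a := T a * R a.
have P_nat a : b a != 0 -> nat_laurent_nz d (P a).
  by move=> ba; apply: nat_laurentM => //; apply: T_nat.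
have [C PC] : exists C : nat, forall a e, 0 < (P a)@_e -> `|e| <= C%:Z.
  have [c cP] := fin_all_exists (fun a => support_bounded (P a)).
  exists (\max_a c a)%N => a e /cP; have := @leq_bigmax A c a.
  by move: (\max_a c a)%N => m; clear; lia.
have [L connP] := window_connected d_gt0 d_def.
(* This length is enough for [window_convex] and for [window_core] up to [L]. *)
pose w := window d (C + L).
have w_nat : nat_laurent_nz d w := window_nat d_gt0 _.
pose F a := if b a == 0 then fK a * (D * w) else P a * w.
have F_natK a : b a != 0 -> nat_laurent_nz d (F a).
  by rewrite /F => /[dup] ba /negbTE->; apply: nat_laurentM => //; apply: P_nat.
have F_nat a : nat_laurent_nz d (F a).
  have [ba|ba] := eqVneq (b a) 0; last exact: F_natK.
  rewrite /F ba eqxx; apply: nat_laurentM; last exact: nat_laurentM.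
  by apply: fK_nat; rewrite defK inE ba.
exists F; split=> //.
- apply: toQX_inj; rewrite raddf0 raddf_sum (sum_by_sign b).
  transitivity (toQX (D * w) * (\sum_(p in S) toQX (f p) * h_pair y b d p
          + \sum_(k in K) toQX (fK k) * toQX (y k))); last by rewrite fh mulr0.
  rewrite h_pair_sum // !mulrDr; congr (_ + _ + _); rewrite mulr_sumr.
  + apply: eq_bigr => a ba; have ba0 := negbT (gt_eqF ba).
    rewrite /F (negbTE ba0) /P /T ba (DE _ ba0) /= !rmorphM /=.
    have := toQX_den_neq0 d_gt0 (db a) ba0.
    by move=> q0; apply: rescale_quotient.
  + apply: eq_bigr => a ba; have ba0 := negbT (lt_eqF ba).
    rewrite /F (negbTE ba0) /P /T ltNge (ltW ba) (DE _ ba0) /= !rmorphM /=.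
    have := toQX_den_neq0 d_gt0 (db a) ba0.
    by move=> q0; apply: rescale_quotient.
  + apply: eq_big => [a|a ba]; first by rewrite defK inE.
    by rewrite /F ba /= -!rmorphM /=; congr toQX; ring.
(* Both sides are the sum of all [f p], taken by rows and by columns. *)
- have eqT : \sum_(a | 0 < b a) T a = \sum_(a | b a < 0) T a.
    transitivity (\sum_(p in S) f p).
      rewrite (@rowsum_sum _ _ _ [set a | 0 < b a]).
        by apply: eq_big => a; rewrite ?inE // /T => ->.
      by move=> [i j] /SIJ'; rewrite in_setX => /andP[].
    rewrite (@colsum_sum _ _ _ [set a | b a < 0]).
      by apply: eq_big => a; rewrite ?inE // /T => ba; rewrite ltNge (ltW ba).
    by move=> [i j] /SIJ'; rewrite in_setX => /andP[].
  rewrite (sum_by_sign b) [X in _ + X]big1 ?addr0; last first.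
    by move=> a /eqP->; rewrite lX0 subrr mulr0.
  have e1 : \sum_(a | 0 < b a) F a * (1 - lX (b a)) =
      (\sum_(a | 0 < b a) T a) * (D * w * (1 - lX d)).
    rewrite mulr_suml; apply: eq_bigr => a ba; have ba0 := negbT (gt_eqF ba).
    rewrite /F (negbTE ba0) (DE _ ba0) (den_telescope d_gt0 (db a)) leNgt ba /P.
    by rewrite expr0; ring.
  have e2 : \sum_(a | b a < 0) F a * (1 - lX (b a)) =
      - ((\sum_(a | b a < 0) T a) * (D * w * (1 - lX d))).
    rewrite mulr_suml -sumrN; apply: eq_bigr => a ba; have ba0 := negbT (lt_eqF ba).
    rewrite /F (negbTE ba0) (DE _ ba0) (den_telescope d_gt0 (db a)) (ltW ba) /P.
    by rewrite expr1; ring.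
  by rewrite e1 e2 eqT subrr.
move=> W W0 WF.
have FE a : b a != 0 -> F a = P a * w by rewrite /F => /negbTE->.
have Fconv a u v (p : int) : b a != 0 -> 0 < (F a)@_u -> 0 < (F a)@_v ->
    u <= p <= v -> (d %| p)%Z -> 0 < (F a)@_p.
  move=> ba; rewrite !FE //; apply: (@window_convex _ d_gt0 _ C) => //; first exact: P_nat.
    exact: PC.
  exact: leq_addr.
have Fcore a p : b a != 0 -> (d %| p)%Z -> `|p| <= L%:Z -> 0 < (F a)@_p.
  move=> ba; rewrite FE //; apply: (@window_core _ d_gt0 _ C) => //; first exact: P_nat.
  exact: PC.
have Fd a p : 0 < (F a)@_p -> (d %| p)%Z.
  by have /nat_laurentP[_ _ Fd] := F_nat a; apply: Fd.
have WT a p : b a != 0 -> 0 < (F a)@_p -> W p.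
  apply: (connP (fun a p => 0 < (F a)@_p) W Fd Fcore Fconv W0) => c q _.
  exact: WF.
move=> a p; have [ba ap|ba] := eqVneq (b a) 0; last exact: WT.
have dp := Fd _ _ ap.
have aK : a \in K by rewrite defK inE ba.
have fnn p' : p' \in S -> lnonneg (f p') by case/f_nat.
have fKnn k : k \in K -> lnonneg (fK k) by case/fK_nat.
have dennn c : b c != 0 -> lnonneg (den d (b c)) by case/den_natb.
have Tnn c : b c != 0 -> lnonneg (T c) by case/T_nat.
have Rwnn c : lnonneg (R c * w) by have [] := nat_laurentM (R_nat c) w_nat.
have Dwnn : lnonneg (D * w) by have [] := nat_laurentM D_nat w_nat.
have Snn : lnonneg (\sum_(p in S) f p) by apply: lnonneg_sum.
have Knn : lnonneg (\sum_(k in K) fK k) by apply: lnonneg_sum.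
(* A loop at [p] splits as an exponent [p1] of some [fK k] plus one of [D * w]; the latter splits
   further along [den d (b c)] for any [c] outside [K]. *)
have [p1 Kp1 Dwp] : exists2 p1, 0 < (\sum_(k in K) fK k)@_p1 & 0 < (D * w)@_(p - p1).
  move: ap; rewrite /F ba eqxx => /lposM[]; [exact: fKnn|exact: Dwnn|move=> p1 ap1 wp1].
  by exists p1 => //; apply/lpos_sum => //; exists a.
have {}Dwp c : b c != 0 -> exists2 e, 0 < (den d (b c))@_e & 0 < (R c * w)@_(p - p1 - e).
  by move=> bc; apply/(lposM _ (dennn c bc) (Rwnn c)); rewrite mulrA -DE.
have F_pos c q e : b c != 0 -> 0 < (T c)@_q -> 0 < (R c * w)@_(p - p1 - e) ->
    0 < (F c)@_(q + (p - p1 - e)).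
  by move=> bc Tq Rw; rewrite (FE c bc) /P -mulrA; apply: lposMD (Tnn c bc) (Rwnn c) Tq Rw.
(* Condition (iii) gives [q <= p1]; an upward letter has [e >= 0], so [q + (p - p1 - e) <= p]. *)
have [c1 [u [bc1 c1u up]]] : exists c u, [/\ b c != 0, 0 < (F c)@_u & u <= p].
  have [q] := (degm_leP Knn Snn).1 deg_m _ Kp1.
  case/(lpos_sum _ fnn) => -[i j] ij fq qp1.
  have := SIJ' _ ij; rewrite in_setX !inE /= => /andP[bi _].
  have bi0 := negbT (gt_eqF bi).
  have Tq : 0 < (T i)@_q.
    rewrite /T bi; apply/lpos_sum; first by move=> p' /andP[/fnn].
    by exists (i, j); rewrite //= ij eqxx.
  have [e ie Rw] := Dwp _ bi0; exists i, (q + (p - p1 - e)).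
  split; [exact: bi0|exact: F_pos|].
  by have := den_pos_coef bi ie; move: qp1; clear; lia.
(* Condition (ii) only gives [q >= p1 - d]; a downward letter has [e <= -d], which makes up for the
   loss. *)
have [c2 [v [bc2 c2v pv]]] : exists c v, [/\ b c != 0, 0 < (F c)@_v & p <= v].
  have [q] := (degp_leDP d Knn Snn).1 deg_p _ Kp1.
  case/(lpos_sum _ fnn) => -[i j] ij fq qp1.
  have := SIJ' _ ij; rewrite in_setX !inE /= => /andP[_ bj].
  have bj0 := negbT (lt_eqF bj).
  have Tq : 0 < (T j)@_q.
    rewrite /T [0 < b j]ltNge (ltW bj); apply/lpos_sum; first by move=> p' /andP[/fnn].
    by exists (i, j); rewrite //= ij eqxx.
  have [e je Rw] := Dwp _ bj0; exists j, (q + (p - p1 - e)).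
  split; [exact: bj0|exact: F_pos|].
  by have := den_neg_coef d_gt0 bj je; move: qp1; clear; lia.
have F0 c : b c != 0 -> 0 < (F c)@_0 by move=> bc; apply: Fcore; rewrite ?dvdz0 ?normr0.
(* By convexity [p] lies in the support of [F c2] or [F c1], whose vertices are already known to be
   in [W]. *)
have [p0|p0] := lerP 0 p.
  by apply: (WT c2 _ bc2); apply: (Fconv _ _ _ _ bc2 (F0 _ bc2) c2v _ dp); rewrite p0 pv.
by apply: (WT c1 _ bc1); apply: (Fconv _ _ _ _ bc1 c1u (F0 _ bc1) _ dp); rewrite up ltW.
Qed.

End Backward.

Theorem proposition3p2 (A : finType) (y : A -> laurent) (b : A -> int)
    (I J K : {set A}) (d : nat)
    (defI : I = [set a | 0 < b a])
    (defJ : J = [set a | b a < 0])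
    (defK : K = [set a | b a == 0])
    (I_neq0 : I != set0)
    (J_neq0 : J != set0)
    (defd : d = \big[gcdn/0%N]_(a in I :|: J) `|b a|%N) :
  is_group (generated_semigroup
              (mem (codom (fun a : A => (y a, b a) : ZwrZ)))) <->
  exists (S : {set A * A}) (f : A * A -> laurent) (fK : A -> laurent),
    [/\ double_full I J S,
        forall p, p \in S -> nat_laurent_nz d (f p)
      & forall k, k \in K -> nat_laurent_nz d (fK k)] /\
    [/\ \sum_(p in S) toQX (f p) * h_pair y b d p
          + \sum_(k in K) toQX (fK k) * toQX (y k) = 0,
        (degp (\sum_(k in K) fK k)%R
           <= degp (\sum_(p in S) f p)%R + d%:Z%:E)%E
      & (degm (\sum_(p in S) f p)%R <= degm (\sum_(k in K) fK k)%R)%E].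
Proof.
have d_def : d = \big[gcdn/0%N]_(a | b a != 0) `|b a|%N.
  by rewrite defd; apply: eq_bigl => a; rewrite defI defJ !inE; case: ltgtP.
have /set0Pn[a0 a0I] := I_neq0.
have a0K : a0 \notin K by move: a0I; rewrite defI defK !inE; case: ltgtP.
have db a : (d %| b a)%Z := gcd_dvd a d_def.
have d_gt0 : (0 < d)%N.
  (* If [d] were 0, divisibility would force [b a0 = 0]. *)
  rewrite lt0n; apply: contraNneq a0K => d0; rewrite defK inE.
  by have := db a0; rewrite d0 dvd0z.
apply: iff_trans (is_group_wordP (gen y b) a0) _.
split=> [[w wA w1]|[S [f [fK [[Sfull f_nat fK_nat] [fh deg_p deg_m]]]]]].
  have K0 k : k \in K -> b k = 0 by rewrite defK inE => /eqP.
  have [F [F_nat Fy Fb FK]] := word_content K0 db a0K wA w1.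
  have [S [f [[Sfull f_nat] fh]]] :=
    pairs_of_contents d_gt0 db defI defJ defK F_nat Fy Fb FK.
  by exists S, f, F.
have [F [F_nat Fy Fb conn]] :=
  contents_of_pairs d_gt0 d_def defI defJ defK Sfull f_nat fK_nat fh deg_p deg_m.
by apply: content_word conn => // a; case: (F_nat a).
Qed.
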